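(* Suppose that the parareal algorithm is initialized by global forecasting, i.e. $\mathbf x_0^{n+1}=\mathcal G_{\mathrm{GF}}(\mathbf x_0^0;T^{n+1})$ for $n=0,\dots,M-1$, that the coarse propagator is the local forecast $\mathcal G=\mathcal G_{\mathrm{LF}}$, that the number of processors equals the number $M$ of coarse time intervals, and that the wall time of advancing one fine time step with the fine propagator dominates all other costs and parallel overhead. Then, upon convergence in $K$ parareal iterations, the method realizes, relative to the serial solution with the fine propagator, a speedup of $$S_{\mathrm{GF\text{-}LF}}(K)=\frac{m}{\alpha(1+\mathbf 1_{K>0})+\alpha K\left(M-\frac12(1+K)\right)+(K+1)\bar m-\alpha K},$$ where $\mathbf 1_{A}=1$ if $A$ is true and $\mathbf 1_A=0$ otherwise.
   Context: Let $N,M,\bar m$ be positive integers, $m=\bar m M$, $T_{\mathrm{final}}>0$, $h=T_{\mathrm{final}}/m$, $H=\bar m h$; fine time instances $t^i=ih$ ($0\le i\le m$), coarse time instances $T^n=nH=t^{\bar m n}$ ($0\le n\le M$). The fine propagator $\mathcal F(\boldsymbol\xi;t^i,t^j)\in\mathbb R^N$ propagates a state $\boldsymbol\xi\in\mathbb R^N$ from $t^i$ to $t^j$ ($i\le j$) one fine step at a time, with $\mathcal F(\cdot;t^i,t^k)=\mathcal F(\cdot;t^j,t^k)\circ\mathcal F(\cdot;t^i,t^j)$ for $i\le j\le k$. Forecasts use a memory $\alpha\in\mathbb N$, $1\le\alpha\le\bar m$, and fixed matrices $\mathbf R,\mathbf P\in\mathbb R^{N\times\bar N}$. The local-forecast coarse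 propagator is $$\mathcal G_{\mathrm{LF}}(\boldsymbol\xi;T^n,T^{n+1})=\mathbf P\mathbf R^T\boldsymbol\xi+\mathbf P\sum_{i=1}^{\alpha}\boldsymbol\Gamma_i^n[\mathbf R^T\mathcal F(\boldsymbol\xi;T^n,t^{\bar m n+i})-\mathbf R^T\boldsymbol\xi],$$ and the global forecast is $$\mathcal G_{\mathrm{GF}}(\boldsymbol\xi;T^n)=\mathbf P\mathbf R^T\boldsymbol\xi+\mathbf P\sum_{i=1}^{\alpha}\bar{\boldsymbol\Gamma}_i^n[\mathbf R^T\mathcal F(\boldsymbol\xi;t^0,t^i)-\mathbf R^T\boldsymbol\xi].$$ Here $\boldsymbol\Gamma_i^n,\bar{\boldsymbol\Gamma}_i^n$ are diagonal $\bar N\times\bar N$ matrices with diagonal entries $\gamma_{ij}^n=\mathbf e_{\bar m}^T\boldsymbol\Xi_j^n[\mathbf Z_0\boldsymbol\Xi_j^n]^+\mathbf e_i$ and $\bar\gamma_{ij}^n=\mathbf e_{\bar m n}^T\boldsymbol\Xi_j[\mathbf Z_0\boldsymbol\Xi_j]^+\mathbf e_i$, $j=1,\dots,\bar N$, where $\boldsymbol\Xi_j^n\in\mathbb R^{\bar m\times a}$ and $\boldsymbol\Xi_j\in\mathbb R^{m\times a}$ ($a\le\alpha$) are given matrices with orthonormal columns and $\mathbf Z_0$ extracts the first $\alpha$ entries of a vector. One evaluation of $\mathcal G_{\mathrm{LF}}$ requires $\alpha$ serial fine time steps; the whole global-forecast initialization requires $\alpha$ serial fine steps in the first coarse interval only.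 Parareal algorithm (inputs $\mathcal F$, $\mathcal G$, $\mathbf x_0^0=\mathbf x^0$, tolerance $\epsilon\ge0$): (1) compute an initialization $\mathbf x_0^1,\dots,\mathbf x_0^M$. (2) In parallel, $\mathbf f_0^{n+1}=\mathcal F(\mathbf x_0^n;T^n,T^{n+1})$, $n=0,\dots,M-1$; set $k=0$. (3) While $\|\mathbf f_k^n-\mathbf x_k^n\|>\epsilon\|\mathbf f_k^n\|$ for some $n\in\{k+1,\dots,M-1\}$: (a) if $k=0$, compute in parallel $\mathbf g_0^{n+1}=\mathcal G(\mathbf x_0^n;T^n,T^{n+1})$, $n=1,\dots,M-1$ (and $\mathbf g_0^1=\mathbf g_1^1$); (b) $\mathbf x_{k+1}^k=\mathbf x_k^k$; (c) serially for $n=k,\dots,M-1$: $\mathbf g_{k+1}^{n+1}=\mathcal G(\mathbf x_{k+1}^n;T^n,T^{n+1})$, $\mathbf x_{k+1}^{n+1}=\mathbf g_{k+1}^{n+1}+\mathbf f_k^{n+1}-\mathbf g_k^{n+1}$; (d) in parallel $\mathbf f_{k+1}^{n+1}=\mathcal F(\mathbf x_{k+1}^n;T^n,T^{n+1})$, $n=k,\dots,M-1$; then $k\leftarrow k+1$. (4) Replace $\mathbf x_k^{n+1}$ by $\mathbf f_k^{n+1}$, $n=k,\dots,M-1$. $K$ denotes the final value of $k$. Wall-time accounting: one fine time step costs $\tau>0$ and everything else costs $0$; the serial solution costs $m\tau$; speedup is the ratio of the serial wall time to the parareal wall time. The initialization costs $\alpha\tau$; the first parallel fine sweep (2) costs $\bar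 m\tau$; if $K>0$, the parallel coarse propagation (3a) costs $\alpha\tau$; the serial coarse sweep (3c) in the $k$-th pass through the while loop ($k=1,\dots,K$) costs $(M-k)\alpha\tau$ (the first of its propagations coincides with an earlier one); each parallel fine sweep (3d) costs $(\bar m-\alpha)\tau$, since the $\alpha$ fine steps computed by the coarse propagator are reused. Operations are not pipelined. *)

(* Defs.v *)
From mathcomp Require Import all_boot all_order all_algebra.
From mathcomp Require Import boolp classical_sets reals.

Set Implicit Arguments.
Unset Strict Implicit.
Unset Printing Implicit Defensive.

Import Order.TTheory GRing.Theory Num.Theory.
Local Open Scope ring_scope.

Section Algebra.
Variable R : realType.

Record is_norm (N : nat) (nrm : 'cV[R]_N -> R) : Prop := IsNorm {
  norm_eq0 : forall x, nrm x = 0 -> x = 0;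
  norm_scale : forall c x, nrm (c *: x) = `|c| * nrm x;
  norm_triangle : forall x y, nrm (x + y) <= nrm x + nrm y }.

Record is_pinv (p q : nat) (A : 'M[R]_(p, q)) (X : 'M[R]_(q, p)) : Prop :=
  IsPinv {
    penrose1 : A *m X *m A = A;
    penrose2 : X *m A *m X = X;
    penrose3 : (A *m X)^T = A *m X;
    penrose4 : (X *m A)^T = X *m A }.

(* The Moore-Penrose pseudoinverse; see pinvP for its existence. *)
Definition pinv (p q : nat) (A : 'M[R]_(p, q)) : 'M[R]_(q, p) :=
  xget 0 [set X | is_pinv A X].

Lemma gram_unit (p q : nat) (C : 'M[R]_(p, q)) :
  row_free C -> C *m C^T \in unitmx.
Proof.
move=> freeC; rewrite -row_free_unit -kermx_eq0; apply/eqP/row_matrixP => i.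
rewrite row0; set u := row i _.
have uCC0 : u *m (C *m C^T) = 0 by rewrite -row_mul mulmx_ker row0.
have vv0 : (u *m C) *m (u *m C)^T = 0.
  by rewrite trmx_mul mulmxA -[_ *m C *m C^T]mulmxA uCC0 mul0mx.
have v0 : u *m C = 0.
  apply/rowP => j; rewrite mxE [RHS]mxE.
  move/matrixP/(_ 0 0): vv0; rewrite !mxE => sum0.
  have sq0 : \sum_k ((u *m C) 0 k) ^+ 2 = 0.
    by rewrite -[RHS]sum0; apply: eq_bigr => k _; rewrite [_^T _ _]mxE expr2.
  move/eqP: sq0; rewrite psumr_eq0; last by move=> k _; exact: sqr_ge0.
  by move/allP/(_ j (mem_index_enum j)); rewrite sqrf_eq0 mxE => /eqP.
by apply: (row_free_inj freeC); rewrite v0 mul0mx.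
Qed.

Lemma pinv_mul (p q r : nat) (C : 'M[R]_(p, r)) (B : 'M[R]_(r, q)) :
  row_full C -> row_free B -> exists X, is_pinv (C *m B) X.
Proof.
move=> fullC freeB.
have uB : B *m B^T \in unitmx by exact: gram_unit.
have uC : C^T *m C \in unitmx.
  have := @gram_unit _ _ C^T; rewrite trmxK; apply.
  by rewrite /row_free mxrank_tr.
pose GB := invmx (B *m B^T); pose GC := invmx (C^T *m C).
have GBT : GB^T = GB by rewrite /GB trmx_inv trmx_mul trmxK.
have GCT : GC^T = GC by rewrite /GC trmx_inv trmx_mul trmxK.
pose X := B^T *m GB *m GC *m C^T.
have AX : C *m B *m X = C *m GC *m C^T.
  rewrite /X !mulmxA -(mulmxA C B) -(mulmxA C _ GB) mulmxV //.
  by rewrite mulmx1.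
have XA : X *m (C *m B) = B^T *m GB *m B.
  rewrite /X !mulmxA -(mulmxA _ C^T C) -(mulmxA _ GC) mulVmx //.
  by rewrite mulmx1.
exists X; split.
- rewrite AX !mulmxA -(mulmxA _ C^T C) -(mulmxA _ GC) mulVmx //.
  by rewrite mulmx1.
- rewrite XA /X !mulmxA -(mulmxA _ B B^T) -(mulmxA _ (B *m B^T) GB) mulmxV //.
  by rewrite mulmx1.
- by rewrite AX !trmx_mul GCT trmxK mulmxA.
- by rewrite XA !trmx_mul GBT trmxK mulmxA.
Qed.

Lemma pinvP (p q : nat) (A : 'M[R]_(p, q)) : is_pinv A (pinv A).
Proof.
suff [X AX] : exists X, is_pinv A X by exact: (xgetPex 0 (ex_intro _ X AX)).
rewrite -(mulmx_base A); apply: pinv_mul; first exact: col_base_full.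
exact: row_base_free.
Qed.

(* [unit_vec d k] is the k-th canonical unit vector of R^d, for 1 <= k <= d. *)
Definition unit_vec (d k : nat) : 'cV[R]_d := \col_(i < d) (i.+1 == k)%:R.

End Algebra.

Section Times.
Variable R : realType.
Variables (Tfinal : R) (mbar M : nat).

Definition fine_step : R := Tfinal / (mbar * M)%:R.
Definition coarse_step : R := mbar%:R * fine_step.
Definition fine_time (i : nat) : R := i%:R * fine_step.
Definition coarse_time (n : nat) : R := n%:R * coarse_step.

End Times.

Section Forecast.
Variable R : realType.
Variables (N Nbar a alpha mbar M : nat) (Tfinal : R).

Local Notation t := (fine_time Tfinal mbar M).
Local Notation T := (coarse_time Tfinal mbar M).

(* [F xi t0 t1] is the fine propagator F(xi; t0, t1). *)
Variable F : 'cV[R]_N -> R -> R -> 'cV[R]_N.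
Variables Rmx Pmx : 'M[R]_(N, Nbar).

(* e_l^T Xi [Z_0 Xi]^+ e_i, where Z_0 = pid_mx alpha keeps the first alpha
   entries. *)
Definition forecast_coef (d : nat) (Xi : 'M[R]_(d, a)) (l i : nat) : R :=
  ((unit_vec R d l)^T *m Xi *m pinv ((pid_mx alpha : 'M_(alpha, d)) *m Xi)
     *m unit_vec R alpha i) 0 0.

(* Xi_loc n j is Xi_j^n. *)
Variable Xi_loc : nat -> 'I_Nbar -> 'M[R]_(mbar, a).

Definition Gamma_loc (n i : nat) : 'M[R]_Nbar :=
  diag_mx (\row_j forecast_coef (Xi_loc n j) mbar i).

(* G_LF xi n is G_LF(xi; T^n, T^{n+1}). *)
Definition G_LF (xi : 'cV[R]_N) (n : nat) : 'cV[R]_N :=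
  Pmx *m (Rmx^T *m xi)
  + Pmx *m \sum_(1 <= i < alpha.+1)
      Gamma_loc n i *m
        (Rmx^T *m F xi (T n) (t (mbar * n + i)) - Rmx^T *m xi).

Variable Xi_glob : 'I_Nbar -> 'M[R]_(mbar * M, a).

Definition Gamma_glob (n i : nat) : 'M[R]_Nbar :=
  diag_mx (\row_j forecast_coef (Xi_glob j) (mbar * n) i).

(* G_GF xi n is G_GF(xi; T^n). *)
Definition G_GF (xi : 'cV[R]_N) (n : nat) : 'cV[R]_N :=
  Pmx *m (Rmx^T *m xi)
  + Pmx *m \sum_(1 <= i < alpha.+1)
      Gamma_glob n i *m (Rmx^T *m F xi (t 0) (t i) - Rmx^T *m xi).

End Forecast.

(* Wall time: a fine time step costs tau, every other operation is free. *)
Section WallTime.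
Variable R : realType.
Variables (tau : R) (alpha mbar M nproc : nat).

(* Cost of running the fine propagator from t^i to t^j. *)
Definition fine_cost (i j : nat) : R := tau *+ (j - i).

Definition serial_time (lo hi : nat) (c : nat -> R) : R :=
  \sum_(lo <= n < hi) c n.

(* Processor p < nproc carries out, one after the other, the tasks of the
   coarse intervals n = p modulo nproc; the phase ends with the slowest one. *)
Definition parallel_time (lo hi : nat) (c : nat -> R) : R :=
  \big[Num.max/0]_(p < nproc)
    \sum_(lo <= n < hi | (n %% nproc)%N == p) c n.

(* The states at t^1, ..., t^alpha come from a single run of F. *)
Definition GF_init_cost : R := fine_cost 0 alpha.

Definition fine_sweep_cost (n : nat) : R :=
  fine_cost (mbar * n) (mbar * n.+1).

(* Likewise, one evaluation of G_LF on the n-th coarse interval. *)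
Definition LF_cost (n : nat) : R :=
  fine_cost (mbar * n) (mbar * n + alpha).

(* Fine propagation over the n-th coarse interval, once the alpha fine steps
   made by the coarse propagator are reused. *)
Definition fine_rest_cost (n : nat) : R :=
  fine_cost (mbar * n + alpha) (mbar * n.+1).

Definition serial_solution_time : R := fine_cost 0 (mbar * M).

End WallTime.

(* With k = iteration s, the functions xs s, fs s and gs s are
   n |-> x_k^n, f_k^n, g_k^n; wall s is the wall time elapsed so far. *)
Record pr_state (R : realType) (N : nat) := PrState {
  iteration : nat;
  xs : nat -> 'cV[R]_N;
  fs : nat -> 'cV[R]_N;
  gs : nat -> 'cV[R]_N;
  wall : R }.

(* v^{n+1} := new n for n = lo, ..., hi - 1; other entries are kept. *)
Definition assign (V : Type) (lo hi : nat) (new old : nat -> V) : nat -> V :=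
  fun n => if (lo < n <= hi)%N then new n.-1 else old n.

(* Parareal with global-forecast initialization and local-forecast coarse
   propagator; the wall time charged to each phase is specific to these. *)
Section Parareal.
Variable R : realType.
Variables (N Nbar a alpha mbar M nproc : nat) (Tfinal tau eps : R).
Variable nrm : 'cV[R]_N -> R.
Variable F : 'cV[R]_N -> R -> R -> 'cV[R]_N.
Variables Rmx Pmx : 'M[R]_(N, Nbar).
Variable Xi_loc : nat -> 'I_Nbar -> 'M[R]_(mbar, a).
Variable Xi_glob : 'I_Nbar -> 'M[R]_(mbar * M, a).
Variable x0 : 'cV[R]_N.

Local Notation T := (coarse_time Tfinal mbar M).
Local Notation fine xi n := (F xi (T n) (T n.+1)).
Local Notation G := (G_LF alpha M Tfinal F Rmx Pmx Xi_loc).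
Local Notation GGF := (G_GF alpha Tfinal F Rmx Pmx Xi_glob).
Local Notation par_time := (parallel_time nproc).
Local Notation ser_time := serial_time.
Local Notation cLF := (LF_cost tau alpha mbar).

(* Initialization, then the first parallel fine sweep. At k = 0, gs is not
   yet defined and is overwritten before it is read. *)
Definition pr_start : pr_state R N :=
  let x := assign 0 M (fun n => GGF x0 n.+1) (fun=> x0) in
  PrState 0 x
    (assign 0 M (fun n => fine (x n) n) (fun=> 0))
    (fun=> 0)
    (GF_init_cost tau alpha + par_time 0 M (fine_sweep_cost tau mbar)).

Definition pr_continue (s : pr_state R N) : bool :=
  [exists n : 'I_M, (iteration s < n)%N &&
     (nrm (fs s n - xs s n) > eps * nrm (fs s n))].

(* x_{k+1}^n, from x_k, f_k and g_k; x_{k+1}^k = x_k^k, and the entries n < k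
   are final and are kept. *)
Fixpoint pr_sweep (k : nat) (x f g : nat -> 'cV[R]_N) (n : nat) : 'cV[R]_N :=
  match n with
  | 0 => x 0
  | n'.+1 =>
      if (k <= n' < M)%N
      then G (pr_sweep k x f g n') n' + f n'.+1 - g n'.+1
      else x n'.+1
  end.

(* One pass of the while loop.
   - For k = 0 the entry g_0^1 is g_1^1 = G(x_1^0; T^0, T^1), where
     x_1^0 = x_0^0; it takes no part in the parallel coarse propagation, whose
     cost therefore ranges over n = 1, ..., M - 1.
   - In the serial coarse sweep, the propagation at n = k starts from
     x_{k+1}^k = x_k^k: its fine steps were made in the previous pass or, for
     k = 0, during the initialization. Hence only n = k + 1, ..., M - 1 is
     charged. *)
Definition pr_pass (s : pr_state R N) : pr_state R N :=
  let k := iteration s in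
  let gk := if k == 0%N then assign 0 M (fun n => G (xs s n) n) (gs s)
            else gs s in
  let x' := pr_sweep k (xs s) (fs s) gk in
  PrState k.+1 x'
    (assign k M (fun n => fine (x' n) n) (fs s))
    (assign k M (fun n => G (x' n) n) gk)
    (wall s
     + (if k == 0%N then par_time 1 M cLF else 0)
     + ser_time k.+1 M cLF
     + par_time k M (fine_rest_cost tau alpha mbar)).

Inductive pr_loop : pr_state R N -> pr_state R N -> Prop :=
| pr_loop_stop s : ~~ pr_continue s -> pr_loop s s
| pr_loop_pass s s' :
    pr_continue s -> pr_loop (pr_pass s) s' -> pr_loop s s'.

Definition pr_finish (s : pr_state R N) : pr_state R N :=
  PrState (iteration s)
    (assign (iteration s) M (fun n => fs s n.+1) (xs s)) (fs s) (gs s) (wall s).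

(* The algorithm stops in the final state s. *)
Definition parareal_GF_LF (s : pr_state R N) : Prop :=
  exists2 s', pr_loop pr_start s' & s = pr_finish s'.

Lemma pr_continue_lt (s : pr_state R N) : pr_continue s -> (iteration s < M)%N.
Proof. by case/existsP=> n /andP[lt_kn _]; exact: ltn_trans lt_kn (ltn_ord n). Qed.

Lemma parareal_GF_LF_terminates : exists s, parareal_GF_LF s.
Proof.
suff run d s : (M - iteration s <= d)%N -> exists s', pr_loop s s'.
  have [s' run_s'] := run M pr_start (leq_subr _ _).
  by exists (pr_finish s'), s'.
elim: d s => [|d IHd] s le_d; have [cont_s|stop_s] := boolP (pr_continue s);
  try by [exists s; exact: pr_loop_stop].
  by move: (pr_continue_lt cont_s); rewrite -subn_gt0 ltnNge le_d.
have [|s' run_s'] := IHd (pr_pass s); last by exists s'; exact: pr_loop_pass.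
by rewrite /= leq_subLR addSnnS -leq_subLR.
Qed.

End Parareal.

(* Main.v *)
(** The wall time depends on the run only through the number K of passes: with
    one processor per coarse interval a parallel phase costs as much as one of
    its tasks, and the K serial coarse sweeps contribute
    alpha ((M - 1) + ... + (M - K)). *)

Require Import Defs.
From mathcomp Require Import all_boot all_order all_algebra.
From mathcomp Require Import reals.
From mathcomp Require Import ring.

Set Implicit Arguments.
Unset Strict Implicit.
Unset Printing Implicit Defensive.

Import Order.TTheory GRing.Theory Num.Theory.
Local Open Scope ring_scope.

(** With one processor per coarse interval, reduction modulo [M] fixes every index below [M], so
    processor [p] has the single task [p], or none when [p < lo]. *)
Lemma big_nat_modn_eq (V : nmodType) (lo M p : nat) (c : nat -> V) :
  (p < M)%N ->
  \sum_(lo <= n < M | (n %% M)%N == p) c n = if (lo <= p)%N then c p else 0.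
Proof.
move=> lt_pM; rewrite big_nat_cond.
rewrite (eq_bigl (fun n => (lo <= n < M)%N && (n == p))); last first.
  by move=> n; case: (ltnP n M) => [/modn_small ->|]; rewrite ?andbF.
by rewrite -big_nat_cond big_nat1_eq lt_pM andbT.
Qed.

Lemma parallel_time_cst (R : realType) (lo M : nat) (c : nat -> R) (v : R) :
  (lo < M)%N -> 0 <= v -> c =1 (fun=> v) -> parallel_time M lo M c = v.
Proof.
move=> lt_loM v_ge0 c_v; rewrite /parallel_time.
under eq_bigr => p _ do rewrite big_nat_modn_eq // c_v.
(* Idle processors contribute [0], which [0 <= v] keeps below the maximum; processor [lo] is busy
   and attains [v]. *)
apply/le_anti/andP; split; first by apply: bigmax_le => // p _; case: ifP.
by apply: (bigmax_sup (Ordinal lt_loM)) => //=; rewrite leqnn.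
Qed.

Lemma fine_sweep_costE (R : realType) (tau : R) (mbar n : nat) :
  fine_sweep_cost tau mbar n = tau * mbar%:R.
Proof. by rewrite /fine_sweep_cost /fine_cost mulnS addnK mulr_natr. Qed.

Lemma LF_costE (R : realType) (tau : R) (alpha mbar n : nat) :
  LF_cost tau alpha mbar n = tau * alpha%:R.
Proof. by rewrite /LF_cost /fine_cost addKn mulr_natr. Qed.

Lemma fine_rest_costE (R : realType) (tau : R) (alpha mbar n : nat) :
  fine_rest_cost tau alpha mbar n = tau * (mbar - alpha)%:R.
Proof.
by rewrite /fine_rest_cost /fine_cost mulnS [(mbar + _)%N]addnC subnDl mulr_natr.
Qed.

(** The denominator of the speedup, read as the wall time in units of [tau] after [K] passes. *)
Definition fine_steps (R : realType) (alpha mbar M K : nat) : R :=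
  alpha%:R * (1 + (0 < K)%N%:R)
  + alpha%:R * K%:R * (M%:R - 2%:R^-1 * (1 + K%:R))
  + (K%:R + 1) * mbar%:R
  - alpha%:R * K%:R.

(** The three added terms are the phases of pass [K.+1]: the parallel coarse propagation, in the
    first pass only, the serial coarse sweep and the shortened fine sweep. The quadratic term is the
    closed form of the sum of the [M - k], for [k] from 1 to [K]. Both hypotheses serve to read the
    truncated subtractions in [R]. *)
Lemma fine_stepsS (R : realType) (alpha mbar M K : nat) :
  (alpha <= mbar)%N -> (K < M)%N ->
  fine_steps R alpha mbar M K.+1 =
    fine_steps R alpha mbar M K + alpha%:R * (K == 0%N)%:R
    + alpha%:R * (M - K.+1)%:R + (mbar - alpha)%:R.
Proof.
move=> le_am lt_KM; rewrite /fine_steps !natrB // -!natr1.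
(* The case split evaluates the indicators of [0 < K] and [K == 0]. *)
by case: K lt_KM => [|K] _ /=; rewrite -?natr1; field.
Qed.

Lemma wall_pr_start (R : realType) (N Nbar a alpha mbar M : nat)
    (Tfinal tau : R) (F : 'cV[R]_N -> R -> R -> 'cV[R]_N)
    (Rmx Pmx : 'M[R]_(N, Nbar)) (Xi_glob : 'I_Nbar -> 'M[R]_(mbar * M, a))
    (x0 : 'cV[R]_N) :
  (0 < M)%N -> 0 <= tau ->
  wall (pr_start alpha M Tfinal tau F Rmx Pmx Xi_glob x0) =
    tau * fine_steps R alpha mbar M 0.
Proof.
move=> M_gt0 tau_ge0 /=.
rewrite (parallel_time_cst (v := tau * mbar%:R)) ?mulr_ge0 //; last first.
  by move=> n; exact: fine_sweep_costE.
rewrite /GF_init_cost /fine_cost subn0 /fine_steps /=; ring.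
Qed.

Lemma wall_pr_pass (R : realType) (N Nbar a alpha mbar M : nat)
    (Tfinal tau eps : R) (nrm : 'cV[R]_N -> R)
    (F : 'cV[R]_N -> R -> R -> 'cV[R]_N) (Rmx Pmx : 'M[R]_(N, Nbar))
    (Xi_loc : nat -> 'I_Nbar -> 'M[R]_(mbar, a)) (s : pr_state R N) :
  (alpha <= mbar)%N -> 0 <= tau -> pr_continue M eps nrm s ->
  wall (pr_pass alpha M M Tfinal tau F Rmx Pmx Xi_loc s) =
    wall s + tau * (fine_steps R alpha mbar M (iteration s).+1
                    - fine_steps R alpha mbar M (iteration s)).
Proof.
move=> le_am tau_ge0 cont_s; have lt_kM := pr_continue_lt cont_s.
rewrite fine_stepsS //= /serial_time.
under eq_bigr do rewrite LF_costE.
rewrite sumr_const_nat -[_ *+ (M - _)]mulr_natr.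
rewrite (parallel_time_cst (lo := iteration s) (v := tau * (mbar - alpha)%:R))
  ?mulr_ge0 //; last by move=> n; exact: fine_rest_costE.
(* The conditional cost becomes a product with an indicator, the form it has in [fine_stepsS]. *)
have -> : (if iteration s == 0%N
           then parallel_time M 1 M (LF_cost tau alpha mbar) else 0) =
          tau * (alpha%:R * (iteration s == 0%N)%:R).
  case: eqP => [k0|_]; last by rewrite !mulr0.
  rewrite mulr1; apply: parallel_time_cst; rewrite ?mulr_ge0 //.
    (* A pass at k = 0 needs an unconverged index 0 < n < M. *)
    case/existsP: cont_s => n /andP[lt_kn _].
    by apply: leq_ltn_trans (ltn_ord n); rewrite -k0.
  by move=> n; exact: LF_costE.
ring.
Qed.

(** The costs of the individual passes are increments of [fine_steps], so they telescope along the
    loop. *)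
Lemma wall_pr_loop (R : realType) (N Nbar a alpha mbar M : nat)
    (Tfinal tau eps : R) (nrm : 'cV[R]_N -> R)
    (F : 'cV[R]_N -> R -> R -> 'cV[R]_N) (Rmx Pmx : 'M[R]_(N, Nbar))
    (Xi_loc : nat -> 'I_Nbar -> 'M[R]_(mbar, a)) (s s' : pr_state R N) :
  (alpha <= mbar)%N -> 0 <= tau ->
  pr_loop alpha M M Tfinal tau eps nrm F Rmx Pmx Xi_loc s s' ->
  wall s' = wall s + tau * (fine_steps R alpha mbar M (iteration s')
                            - fine_steps R alpha mbar M (iteration s)).
Proof.
move=> le_am tau_ge0; elim=> {s s'} [s _|s s' cont_s _ ->].
  by rewrite subrr mulr0 addr0.
rewrite (wall_pr_pass _ _ _ _ _ le_am tau_ge0 cont_s) /=; ring.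
Qed.

Theorem theorem4p5 (R : realType)
  (N M mbar m Nbar a alpha nproc : nat) (Tfinal tau eps : R)
  (nrm : 'cV[R]_N -> R)
  (F : 'cV[R]_N -> R -> R -> 'cV[R]_N)
  (Rmx Pmx : 'M[R]_(N, Nbar))
  (Xi_loc : nat -> 'I_Nbar -> 'M[R]_(mbar, a))
  (Xi_glob : 'I_Nbar -> 'M[R]_(mbar * M, a))
  (x0 : 'cV[R]_N) (s : pr_state R N) (K : nat)
  (N_gt0 : (0 < N)%N) (M_gt0 : (0 < M)%N) (mbar_gt0 : (0 < mbar)%N)
  (m_def : m = (mbar * M)%N)
  (alpha_bounds : (1 <= alpha <= mbar)%N) (a_le_alpha : (a <= alpha)%N)
  (Tfinal_gt0 : 0 < Tfinal) (tau_gt0 : 0 < tau) (eps_ge0 : 0 <= eps)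
  (nrm_norm : is_norm nrm)
  (F_comp : forall (xi : 'cV[R]_N) (i j k : nat),
     (i <= j)%N -> (j <= k)%N -> (k <= m)%N ->
     let t := fine_time Tfinal mbar M in
     F xi (t i) (t k) = F (F xi (t i) (t j)) (t j) (t k))
  (Xi_loc_orth : forall (n : nat) (j : 'I_Nbar), (n < M)%N ->
     (Xi_loc n j)^T *m Xi_loc n j = 1%:M)
  (Xi_glob_orth : forall j : 'I_Nbar, (Xi_glob j)^T *m Xi_glob j = 1%:M)
  (nproc_M : nproc = M)
  (run : parareal_GF_LF alpha nproc Tfinal tau eps nrm F Rmx Pmx
           Xi_loc Xi_glob x0 s)
  (K_def : K = iteration s) :
  serial_solution_time tau mbar M / wall s =
    m%:R / (alpha%:R * (1 + (0 < K)%N%:R)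
            + alpha%:R * K%:R * (M%:R - 2%:R^-1 * (1 + K%:R))
            + (K%:R + 1) * mbar%:R
            - alpha%:R * K%:R).
Proof.
move: run; rewrite nproc_M => -[s' run_s' s_def].
have tau_ge0 := ltW tau_gt0; have /andP[_ le_am] := alpha_bounds.
have -> : wall s = tau * fine_steps R alpha mbar M K.
  (* [pr_finish] changes neither the iteration count nor the wall time; the cost of the start
     cancels the last term of the telescoped sum. *)
  rewrite K_def s_def /= (wall_pr_loop le_am tau_ge0 run_s') wall_pr_start //=.
  by rewrite -mulrDr addrC subrK.
rewrite /serial_solution_time /fine_cost subn0 -m_def -[tau *+ m]mulr_natr.
(* The common factor [tau] cancels because it is nonzero. *)
by rewrite -mulf_div divff ?mul1r // gt_eqF.
Qed.
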